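(* Let $T$ be a forest that is not a subgraph of a $1$-subdivided tree, and let $k$ be a positive integer. Then the class of all $(T,C_4,\dots,C_{2k},\text{odd hole})$-free graphs is not $\chi_s$-bounded.
   Context: All graphs are finite, simple and undirected. A $1$-subdivided tree is a graph obtained from a tree by subdividing each edge by exactly one vertex. $C_n$ is the cycle of length $n$. An odd hole is an induced cycle of odd length at least $5$. A graph is $(T,C_4,\dots,C_{2k},\text{odd hole})$-free if it contains none of $T$, $C_4,\dots,C_{2k}$ as an induced subgraph and contains no odd hole (for $k=1$ the list $C_4,\dots,C_{2k}$ is empty). The star chromatic number $\chi_s(G)$ is the minimum number of colors in a proper coloring of $G$ such that the union of any two color classes induces a star forest. A hereditary class $\mathscr C$ is $\chi_s$-bounded if there is a function $f$ such that $\chi_s(G)\leq f(\omega(G))$ for every $G\in\mathscr C$, where $\omega$ is the clique number. *)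

(* Defs.v *)
From mathcomp Require Import all_boot.
Set Implicit Arguments.
Unset Strict Implicit.
Unset Printing Implicit Defensive.

Record sgraph := SGraph {
  vertex :> finType;
  adj : rel vertex;
  adj_sym : symmetric adj;
  adj_irr : irreflexive adj }.

Notation "x -- y" := (adj x y) (at level 30).

Definition subgraph (H G : sgraph) : Prop :=
  exists2 f : H -> G, injective f & forall x y : H, x -- y -> f x -- f y.

Definition induced_subgraph (H G : sgraph) : Prop :=
  exists2 f : H -> G, injective f & forall x y : H, f x -- f y = x -- y.

Section Induced.
Variables (G : sgraph) (A : {set G}).
Definition induced_adj : rel {x : G | x \in A} := fun x y => val x -- val y.
Fact induced_sym : symmetric induced_adj.
Proof. by move=> x y; apply: adj_sym. Qed.
Fact induced_irr : irreflexive induced_adj.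
Proof. by move=> x; apply: adj_irr. Qed.
Definition induced : sgraph := SGraph induced_sym induced_irr.
End Induced.

(* The size bound discards the empty sequence and the pairs [:: x; y] with
   x -- y, which are also ucycles. *)
Definition is_forest (G : sgraph) : Prop :=
  forall c : seq G, ucycle (@adj G) c -> size c < 3.

Definition is_connected (G : sgraph) : Prop :=
  0 < #|G| /\ forall x y : G, connect (@adj G) x y.

Definition is_tree (G : sgraph) : Prop := is_connected G /\ is_forest G.

(* The vertices of the 1-subdivision are those of G together with one vertex
   for each edge {x, y} of G, joined exactly to x and y. *)
Section Subdivision.
Variable G : sgraph.
Definition edge_set : {set {set G}} :=
  [set e : {set G} | [exists x, exists y, x -- y && (e == [set x; y])]].
Definition subdivision_adj : rel (G + {e : {set G} | e \in edge_set}) :=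
  fun u v => match u, v with
             | inl x, inr e => x \in val e
             | inr e, inl x => x \in val e
             | _, _ => false
             end.
Fact subdivision_sym : symmetric subdivision_adj.
Proof. by case=> [x|e] [y|f]. Qed.
Fact subdivision_irr : irreflexive subdivision_adj.
Proof. by case. Qed.
Definition subdivision : sgraph := SGraph subdivision_sym subdivision_irr.
End Subdivision.

(* ordS is the cyclic successor on 'I_n. The condition i != j only matters for
   n = 1; the result is the cycle of length n when n >= 3. *)
Section Cycle.
Variable n : nat.
Definition cycle_adj : rel 'I_n :=
  fun i j => (i != j) && ((j == ordS i) || (i == ordS j)).
Fact cycle_sym : symmetric cycle_adj.
Proof. by move=> i j; rewrite /cycle_adj eq_sym orbC. Qed.
Fact cycle_irr : irreflexive cycle_adj.
Proof. by move=> i; rewrite /cycle_adj eqxx. Qed.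
Definition cycle_graph : sgraph := SGraph cycle_sym cycle_irr.
End Cycle.

Definition has_odd_hole (G : sgraph) : Prop :=
  exists n, [/\ odd n, 5 <= n & induced_subgraph (cycle_graph n) G].

(* All cycles of lengths 4 to 2k are excluded. Excluding only the even lengths
   yields the same class, since those of odd length >= 5 are odd holes. *)
Definition free_class (T : sgraph) (k : nat) (G : sgraph) : Prop :=
  [/\ ~ induced_subgraph T G,
      forall n, 4 <= n <= 2 * k -> ~ induced_subgraph (cycle_graph n) G
    & ~ has_odd_hole G].

Definition is_star (G : sgraph) : bool :=
  [exists c : G, forall x : G, forall y : G,
     x -- y == (x != y) && ((x == c) || (y == c))].

Definition component (G : sgraph) (x : G) : {set G} :=
  [set y | connect (@adj G) x y].

Definition is_star_forest (G : sgraph) : bool :=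
  [forall x : G, is_star (induced (component x))].

Section StarColoring.
Variables (G : sgraph) (k : nat).

Definition proper_coloring (c : G -> 'I_k) : bool :=
  [forall x : G, forall y : G, x -- y ==> (c x != c y)].

Definition color_class (c : G -> 'I_k) (i : 'I_k) : {set G} :=
  [set x | c x == i].

Definition star_coloring (c : G -> 'I_k) : bool :=
  proper_coloring c &&
  [forall i : 'I_k, forall j : 'I_k, (i != j) ==>
     is_star_forest (induced (color_class c i :|: color_class c j))].

Definition star_colorable : bool :=
  [exists c : {ffun G -> 'I_k}, star_coloring c].
End StarColoring.

Lemma star_colorable_card (G : sgraph) : star_colorable G #|G|.
Proof.
apply/existsP; exists [ffun x => enum_rank x]; apply/andP; split.
  apply/forallP=> x; apply/forallP=> y; apply/implyP=> xy.
  rewrite !ffunE; apply/eqP=> /enum_rank_inj exy.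
  by rewrite exy adj_irr in xy.
apply/forallP=> i; apply/forallP=> j; apply/implyP=> _.
set H := induced _.
have H2 (u v w : H) : [|| u == v, u == w | v == w].
  have E (z : H) : (val z == enum_val i) || (val z == enum_val j).
    have := valP z; rewrite !inE !ffunE.
    by rewrite -!(can_eq (@enum_rankK G)) !enum_valK.
  rewrite -!val_eqE /=.
  by case/orP: (E u) => /eqP->; case/orP: (E v) => /eqP->;
     case/orP: (E w) => /eqP->; rewrite ?eqxx ?orbT.
clearbody H.
have adjH (x y : H) : connect (@adj H) x y -> x != y -> x -- y.
  case/connectP=> -[|z p] /=; first by move=> _ ->; rewrite eqxx.
  case/andP=> xz _ _ xy; have := H2 x y z; rewrite (negPf xy) /=.
  by case/orP=> /eqP e; [rewrite -e adj_irr in xz | rewrite e].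
apply/forallP=> x; apply/existsP.
have xx : x \in component x by rewrite inE connect0.
exists (Sub x xx); apply/forallP=> -[u xu]; apply/forallP=> -[v xv].
rewrite /= /induced_adj -!val_eqE /=; apply/eqP.
move: xu xv; rewrite !inE => xu xv.
have [->|uv] := eqVneq u v; first exact: adj_irr.
have := H2 u v x; rewrite (negPf uv) /= => /orP[]/eqP e; subst x.
  by rewrite eqxx adjH.
by rewrite eqxx orbT adj_sym adjH // eq_sym.
Qed.

Fact star_colorable_ex (G : sgraph) : exists k, star_colorable G k.
Proof. by exists #|G|; apply: star_colorable_card. Qed.

Definition star_chromatic_number (G : sgraph) : nat :=
  ex_minn (star_colorable_ex G).

Definition is_clique (G : sgraph) (A : {set G}) : bool :=
  [forall x in A, forall y in A, (x != y) ==> x -- y].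

Definition clique_number (G : sgraph) : nat :=
  \max_(A : {set G} | is_clique A) #|A|.

Definition hereditary (C : sgraph -> Prop) : Prop :=
  forall G H : sgraph, induced_subgraph H G -> C G -> C H.

Definition chi_s_bounded (C : sgraph -> Prop) : Prop :=
  exists f : nat -> nat, forall G : sgraph,
    C G -> star_chromatic_number G <= f (clique_number G).

Lemma induced_subgraph_trans (G H K : sgraph) :
  induced_subgraph K H -> induced_subgraph H G -> induced_subgraph K G.
Proof.
case=> f fI fE [g gI gE]; exists (g \o f); first exact: inj_comp.
by move=> x y; rewrite /= gE fE.
Qed.

Lemma free_class_hereditary (T : sgraph) (k : nat) :
  hereditary (free_class T k).
Proof.
move=> G H HG [nT nC nO]; split.
- by move=> TH; apply/nT/(induced_subgraph_trans TH).
- by move=> n kn CH; apply: (nC n kn); apply: induced_subgraph_trans CH HG.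
- case=> n [on n5 CH]; apply: nO; exists n; split=> //.
  exact: induced_subgraph_trans CH HG.
Qed.

(* Main.v *)
Require Import Defs.
From mathcomp Require Import all_boot zify.
Set Implicit Arguments.
Unset Strict Implicit.
Unset Printing Implicit Defensive.

(* Let H be a graph of large girth without large independent sets, and G its
   1-subdivision. G is bipartite, so it has no odd hole and clique number at
   most 2, and its short cycles would come from short cycles of H. A copy of T
   in G only involves at most 2|T| vertices of H, which span a forest, so T would
   be a subgraph of a subdivided tree. Finally, a star colouring of G with m
   colours yields an independent set of H of size at least |H| / (m (m + 1)).

   The graph H comes from a counting argument with random maps
   f : V * L -> V, each arc (v, i) being read as an edge from v to f (v, i). The
   average number of short cycles is bounded independently of |V|, whereas the
   probability that some set of size |V| / q contains none of its arcs, even up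
   to boundedly many exceptions, tends to 0 as |V| grows. Deleting the arcs that
   lie on short cycles therefore leaves a graph as required. *)

(** * Counting maps with short cycles *)

Lemma leq_card_bigcup (I T : finType) (P : pred I) (F : I -> {set T}) :
  #|\bigcup_(i | P i) F i| <= \sum_(i | P i) #|F i|.
Proof.
elim/big_rec2: _ => [|i m A _ le]; first by rewrite cards0.
by apply: leq_trans (leq_card_setU _ _) _; rewrite leq_add2l.
Qed.

(** Values at distinct points are chosen independently, so the count is a product with one factor
    per point: at most [b] on [P] and at most [#|B|] elsewhere. *)
Lemma card_ffun_constrained (A B : finType) (P : {set A}) (F : A -> {set B}) b :
    {in P, forall p, #|F p| <= b} ->
  #|[set f : {ffun A -> B} | [forall p in P, f p \in F p]]|
    <= b ^ #|P| * #|B| ^ #|~: P|.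
Proof.
move=> Fb; pose F' p := if p \in P then F p else setT.
have -> : #|[set f : {ffun A -> B} | [forall p in P, f p \in F p]]|
          = \prod_(p : A) #|F' p|.
  rewrite -[RHS]big_enum /= -(big_map (fun p => #|F' p|) predT id).
  rewrite -foldrE -card_family; apply: eq_card => f.
  rewrite inE; apply/forall_inP/familyP => [h p | h p pP].
    by rewrite /F'; case: ifP => [/h|]; rewrite ?inE.
  by have := h p; rewrite /F' pP.
rewrite (bigID (mem P)) /= leq_mul //.
  rewrite -prod_nat_const; apply: leq_prod => p pP.
  by rewrite /F' pP; apply: Fb.
rewrite -prod_nat_const big_mkcond [X in _ <= X]big_mkcond /=.
by apply: leq_prod => p _; rewrite inE /F'; case: (p \in P); rewrite ?cardsT.
Qed.

Section RandomMap.
Variables V L : finType.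
Implicit Type f : {ffun V * L -> V}.

(* A closed walk is the word of its steps (x_j, i_j, b_j): step j leads from x_j
   to x_(j+1) along an arc labelled i_j, traversed forwards when b_j holds and
   backwards otherwise. *)
Definition source l (w : {ffun 'I_l.+1 -> V * L * bool}) j : V * L :=
  (if (w j).2 then (w j).1.1 else (w (ordS j)).1.1, (w j).1.2).

Definition target l (w : {ffun 'I_l.+1 -> V * L * bool}) j : V :=
  if (w j).2 then (w (ordS j)).1.1 else (w j).1.1.

Definition cycle_word f l (w : {ffun 'I_l.+1 -> V * L * bool}) :=
  injectiveb (source w) && [forall j, f (source w j) == target w j].

(* As a cycle may be started at any of its steps, the first arcs of all cycles
   already account for every arc of every short cycle. *)
Definition short_arcs g f : {set V * L} :=
  \bigcup_(l < g) [set source w ord0 | w : {ffun 'I_l.+1 -> V * L * bool}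
                                     & cycle_word f w].

(* A cycle of length l.+1 prescribes f at l.+1 distinct arcs. *)
Lemma card_cycle_word l (w : {ffun 'I_l.+1 -> V * L * bool}) :
  #|[set f | cycle_word f w]| * #|V| ^ l.+1 <= #|V| ^ (#|V| * #|L|).
Proof.
have [|] := boolP (injectiveb (source w)); last first.
  move=> /negPf ninj; rewrite (_ : [set _ | _] = set0) ?cards0 //.
  by apply/setP=> f; rewrite !inE /cycle_word ninj.
move/injectiveP=> inj.
pose P := [set source w j | j in 'I_l.+1].
(* [F p] gathers the values prescribed at [p]; injectivity of [source w] makes it a singleton on
   [P]. *)
pose F p := [set target w j | j in [set j | source w j == p]].
have cP : #|P| = l.+1 by rewrite card_imset // card_ord.
have Fb : {in P, forall p, #|F p| <= 1}.
  move=> _ /imsetP[j _ ->]; apply: leq_trans (leq_imset_card _ _) _.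
  rewrite (_ : [set _ | _] = [set j]) ?cards1 //.
  by apply/setP=> i; rewrite !inE (inj_eq inj).
have := card_ffun_constrained Fb; rewrite exp1n mul1n => le1.
apply: (@leq_trans (#|V| ^ #|~: P| * #|V| ^ l.+1)).
  rewrite leq_mul2r; apply/orP; right; apply: leq_trans le1.
  apply/subset_leq_card/subsetP=> f; rewrite !inE => /andP[_ /forallP fw].
  apply/forall_inP=> _ /imsetP[j _ ->]; rewrite (eqP (fw j)).
  by apply: imset_f; rewrite inE.
by rewrite -cP -expnD addnC cardsC card_prod.
Qed.

(** First moment: there are (2 |V| |L|)^(l+1) words of length l+1, each a cycle word for at most a
    fraction |V|^-(l+1) of the maps, so the powers of |V| cancel. *)
Lemma sum_card_short_arcs g :
  \sum_f #|short_arcs g f| <=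
    #|V| ^ (#|V| * #|L|) * \sum_(l < g) (2 * #|L|) ^ l.+1.
Proof.
have step f : #|short_arcs g f| <= \sum_(l < g)
    \sum_(w : {ffun 'I_l.+1 -> V * L * bool}) cycle_word f w.
  apply: (@leq_trans (\sum_(l < g) #|[set source w ord0 |
      w : {ffun 'I_l.+1 -> V * L * bool} & cycle_word f w]|)).
    exact: leq_card_bigcup.
  apply: leq_sum => l _; apply: leq_trans (leq_imset_card _ _) _.
  rewrite -sum1_card big_mkcond /=.
  by apply: leq_sum => w _; rewrite inE; case: cycle_word.
apply: (@leq_trans (\sum_f \sum_(l < g)
    \sum_(w : {ffun 'I_l.+1 -> V * L * bool}) cycle_word f w)).
  by apply: leq_sum => f _; apply: step.
rewrite exchange_big /= big_distrr /=; apply: leq_sum => l _.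
rewrite exchange_big /=.
have le w : \sum_f (cycle_word f w : nat) = #|[set f | cycle_word (l := l) f w]|.
  rewrite -sum1_card [RHS]big_mkcond /=.
  by apply: eq_bigr => f _; rewrite inE; case: cycle_word.
under eq_bigr => w _ do rewrite le.
have [V0|V0] := posnP #|V|.
  rewrite big1 ?leq0n // => w _.
  by have := card0_eq V0 (w ord0).1.1; rewrite inE.
rewrite -(@leq_pmul2r (#|V| ^ l.+1)) ?expn_gt0 ?V0 // big_distrl /=.
apply: (@leq_trans (\sum_(w : {ffun 'I_l.+1 -> V * L * bool}) #|V| ^ (#|V| * #|L|))).
  by apply: leq_sum => w _; apply: card_cycle_word.
rewrite sum_nat_const card_ffun card_ord !card_prod card_bool.
rewrite -[X in _ <= X]mulnA -expnMn [X in X <= _]mulnC.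
by rewrite [X in _ <= _ * X ^ _](_ : _ = #|V| * #|L| * 2) // mulnC (mulnC 2) mulnA.
Qed.

End RandomMap.

(** * Numerical estimates for the union bound *)

Lemma exp2_dominates C t : exists2 a, 0 < a & C * a ^ t <= 2 ^ a.
Proof.
have ex2 b : b < 2 ^ b by apply: ltn_expl.
(* As [a] is 4^s, it suffices that C + 2st <= 4^s, which holds because (s+1)^2 <= 4^s. *)
set s := (C + 2 * t); exists (2 ^ (2 * s)); first by rewrite expn_gt0.
rewrite -expnM.
apply: (@leq_trans (2 ^ C * 2 ^ (2 * s * t))).
  by rewrite leq_mul2r ltnW ?orbT.
rewrite -expnD leq_pexp2l // [X in 2 ^ X](mulnC 2) expnM -mulnn.
apply: leq_trans (leq_mul (ex2 s) (ex2 s)); rewrite /s; nia.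
Qed.

(** This is (1 + 1/u)^u >= 2, from Bernoulli's inequality at x = n = u. *)
Lemma double_expn_leq u : 0 < u -> 2 * u ^ u <= u.+1 ^ u.
Proof.
case: u => // u _.
have bern (x n : nat) : x ^ n + n * x ^ n.-1 <= x.+1 ^ n.
  elim: n => [|n IH]; first by rewrite mul0n addn0.
  rewrite !expnS; apply: leq_trans (leq_mul (leqnn x.+1) IH).
  by case: n IH => [|n] _; rewrite ?expnS /= ?expn0; [lia | move: (x ^ n) => y; nia].
by have := bern u.+1 u.+1; rewrite /= -expnS; lia.
Qed.

Lemma exists_subset_card (T : finType) (A : {set T}) a :
  a <= #|A| -> exists2 B : {set T}, B \subset A & #|B| = a.
Proof.
move=> aA; exists [set x in take a (enum A)].
  by apply/subsetP=> x; rewrite inE => /mem_take; rewrite mem_enum.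
rewrite cardsE (card_uniqP _) ?take_uniq ?enum_uniq //.
by rewrite size_takel // -cardE.
Qed.

(** * Counting the maps that avoid a given set *)

Section AvoidingMaps.
Variables V L : finType.

Definition avoiding (A : {set V}) (D : {set V * L}) : {set {ffun V * L -> V}} :=
  [set f : {ffun V * L -> V} |
    [forall p in setX A setT :\: D, f p \in ~: A]].

(** Here [s] counts the arcs starting in a set of size [a] among (u+1)a vertices. Each constrained
    one costs a factor u/(u+1), and (u/(u+1))^u <= 1/2 with s = u(u+2)a gives 2^-((u+2)a). The at
    most [t] exempted arcs lose a factor (u+1)/u <= 2 each. *)
Lemma avoiding_bound u a t p r : 0 < u ->
    p <= a * (u * u.+2) <= p + t -> p + r = u.+1 * a * (u * u.+2) ->
  (u * a) ^ p * (u.+1 * a) ^ r * 2 ^ (u.+2 * a) <= 2 ^ t * (u.+1 * a) ^ (p + r).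
Proof.
move=> u0; set s := a * _ => /andP[ps st] pr.
have sr : s <= p + r by rewrite pr -mulnA /s; nia.
have mono m n e : m <= n -> m ^ e <= n ^ e by case: e => // e; rewrite leq_exp2r.
have key : u ^ s * 2 ^ (u.+2 * a) <= u.+1 ^ s.
  have -> : s = u * (u.+2 * a) by rewrite /s; lia.
  by rewrite (expnM u) (expnM u.+1) -expnMn mono // mulnC double_expn_leq.
have le2 : u.+1 ^ (s - p) <= 2 ^ t * u ^ (s - p).
  apply: (@leq_trans ((2 * u) ^ (s - p))).
    by apply: mono; lia.
  by rewrite expnMn leq_mul2r leq_pexp2l ?orbT //; lia.
have er : r = (p + r - s) + (s - p) by lia.
have epr : p + r = (p + r - s) + s by lia.
have es : u ^ s = u ^ p * u ^ (s - p) by rewrite -expnD subnKC.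
have qr : u.+1 ^ r = u.+1 ^ (p + r - s) * u.+1 ^ (s - p) by rewrite -expnD -er.
have qpr : u.+1 ^ (p + r) = u.+1 ^ (p + r - s) * u.+1 ^ s by rewrite -expnD -epr.
rewrite !expnMn qr qpr expnD.
have := leq_mul (leqnn (a ^ p * a ^ r * u.+1 ^ (p + r - s) * u ^ p * 2 ^ (u.+2 * a))) le2.
have := leq_mul (leqnn (a ^ p * a ^ r * u.+1 ^ (p + r - s) * 2 ^ t)) key.
rewrite es; move: (a ^ p) (a ^ r) (u ^ p) (u ^ (s - p)) (u.+1 ^ s) (u.+1 ^ (s - p))
  (u.+1 ^ (p + r - s)) (2 ^ t) (2 ^ (u.+2 * a)); clear; lia.
Qed.

Lemma card_avoiding u a t (A : {set V}) (D : {set V * L}) : 0 < u ->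
    #|L| = u * u.+2 -> #|V| = u.+1 * a -> #|A| = a -> #|D| <= t ->
  #|avoiding A D| * 2 ^ (u.+2 * a) <= 2 ^ t * #|V| ^ (#|V| * #|L|).
Proof.
move=> u0 cL cV cA Dt; set P := setX A setT :\: D.
have /(card_ffun_constrained (P := P) (F := fun=> ~: A)) : {in P, forall p, #|~: A| <= u * a}.
  by move=> p _ /=; have := cardsC A; rewrite cA cV mulSn => /addnI->.
move=> le; apply: leq_trans (leq_mul le (leqnn _)) _.
have cX : #|setX A [set: L]| = a * (u * u.+2) by rewrite cardsX cardsT cA cL.
have PC : #|P| + #|~: P| = u.+1 * a * (u * u.+2).
  by rewrite cardsC card_prod cV cL.
rewrite cV cL -PC; apply: avoiding_bound => //.
rewrite -cX -(cardsID D (setX A [set: L])) -/P leq_addl /= addnC leq_add2l.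
exact: leq_trans (subset_leq_card (subsetIr _ _)) Dt.
Qed.
End AvoidingMaps.

(* Union bound over the sets A of size a = #|V| / q and over the sets D of at
   most t arcs that may be short, D being enumerated by a t-tuple c. *)
Lemma exists_map (q g : nat) : 1 < q -> exists (V L : finType) (f : {ffun V * L -> V}),
  0 < #|V| /\ forall A : {set V}, #|V| <= q * #|A| ->
     exists p, [/\ p \notin short_arcs g f, p.1 \in A & f p \in A].
Proof.
case: q => [|[//|u]] // _; set q := u.+2.
(* [d] is the number of labels required by [card_avoiding] with [u.+1] for [u]. As [K] bounds the
   average number of short arcs, Markov's inequality shows that fewer than half of the maps have
   more than t = 2K. *)
pose d := u.+1 * u.+3; pose K := \sum_(l < g) (2 * d) ^ l.+1; pose t := 2 * K.
(* The constant combines the (q a d)^t tuples of exempted arcs, the loss 2^t in [card_avoiding], and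
   a factor 2 so that at most half of the maps are bad. *)
have [a a0 Ha] := exp2_dominates (2 * (2 * (q * d)) ^ t) t.
have [V cV] : exists V : finType, #|V| = q * a by exists 'I_(q * a); rewrite card_ord.
have [L cL] : exists L : finType, #|L| = d by exists 'I_d; rewrite card_ord.
pose N := #|V| ^ (#|V| * #|L|).
have N0 : 0 < N by rewrite expn_gt0 cV; lia.
pose many := [set f : {ffun V * L -> V} | t < #|short_arcs g f|].
have many_small : 2 * #|many| < N.
  have : #|many| * t.+1 <= N * K.
    rewrite /K -cL; apply: leq_trans _ (sum_card_short_arcs V L g).
    rewrite -sum_nat_const big_mkcond /=; apply: leq_sum => f _.
    by rewrite inE; case: ifP.
  by move: N0; rewrite /t; move: #|many| (N) (K); clear => x y z; nia.
pose D (c : {ffun 'I_t -> V * L}) := [set c i | i in 'I_t].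
pose bad := \bigcup_(A : {set V} | #|A| == a)
   \bigcup_(c : {ffun 'I_t -> V * L}) avoiding A (D c).
have bad_small : 2 * #|bad| <= N.
  have : #|bad| * 2 ^ (u.+3 * a) <= 2 ^ (q * a) * ((q * a * d) ^ t * (2 ^ t * N)).
    apply: (@leq_trans (\sum_(A : {set V} | #|A| == a)
        \sum_(c : {ffun 'I_t -> V * L}) #|avoiding A (D c)| * 2 ^ (u.+3 * a))).
      under eq_bigr => A _ do rewrite -big_distrl /=.
      rewrite -big_distrl leq_mul2r; apply/orP; right.
      apply: leq_trans (leq_card_bigcup _ _) _; apply: leq_sum => A _.
      exact: leq_card_bigcup.
    apply: (@leq_trans (\sum_(A : {set V})
        \sum_(c : {ffun 'I_t -> V * L}) 2 ^ t * N)).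
      rewrite big_mkcond /=; apply: leq_sum => A _.
      case: eqP => // cA; apply: leq_sum => c _.
      apply: card_avoiding => //.
      by rewrite -[X in _ <= X](card_ord t) leq_imset_card.
    rewrite !sum_nat_const card_ffun card_prod cV cL card_ord.
    rewrite [X in X * _ <= _](_ : _ = 2 ^ (q * a)) //.
    by rewrite -cV -[#|V|]cardsT -card_powerset powersetT cardsT.
  (* The factor 2^(q a) pays for the choice of [A]; by [Ha], the factor 2^a pays for the rest. *)
  rewrite (_ : u.+3 * a = q * a + a); last by rewrite /q; lia.
  rewrite expnD mulnCA leq_pmul2l ?expn_gt0 //.
  have -> : (q * a * d) ^ t * (2 ^ t * N) = ((2 * (q * d)) ^ t * a ^ t) * N.
    by rewrite mulnA -!expnMn; congr (_ ^ _ * _); lia.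
  have := leq_mul Ha (leqnn N); move: (expn_gt0 2 a).
  move: (_ ^ t) (a ^ t) (2 ^ a) #|bad| (N); clear => x y z b m; nia.
have [f] : exists f, f \notin many :|: bad.
  apply/existsP; rewrite -negb_forall; apply/negP=> /forallP all.
  have : #|many :|: bad| = N.
    by rewrite /N -card_prod -card_ffun; apply: eq_card => f; rewrite all.
  move=> E; have := (leq_card_setU many bad).1; rewrite {}E; move: many_small bad_small.
  move: #|many| #|bad| (N); clear; lia.
rewrite !inE negb_or -leqNgt => /andP[Dt nbad].
exists V, L, f; split=> [|A /=]; first by rewrite cV; lia.
rewrite cV leq_pmul2l // => /exists_subset_card[B BA cB].
(* [p0] pads the list of short arcs to length [t]; an extra arc is harmless, since [D c] only has to
   contain the short ones. *)
have [p0 _] : exists p0 : V * L, true.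
  have : 0 < #|{: V * L}| by rewrite card_prod cV cL !muln_gt0 a0.
  by case/card_gt0P=> p0 _; exists p0.
pose c := [ffun i : 'I_t => nth p0 (enum (short_arcs g f)) i].
have sub : short_arcs g f \subset D c.
  apply/subsetP=> p ps; have pi : index p (enum (short_arcs g f)) < t.
    by apply: leq_trans Dt; rewrite cardE index_mem mem_enum.
  by apply/imsetP; exists (Ordinal pi); rewrite // ffunE nth_index ?mem_enum.
have : f \notin avoiding B (D c).
  apply: contra nbad => fB; apply/bigcupP; exists B; first exact/eqP.
  by apply/bigcupP; exists c.
rewrite inE => /forall_inPn[p]; rewrite !inE negbK => /andP[pD].
rewrite andbT => pB fp; exists p; split; try exact: (subsetP BA).
exact: contra (subsetP sub p) pD.
Qed.

(** * Graphs of large girth without large independent sets *)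

Lemma cycle_nth (T : Type) (e : rel T) x0 c i :
  cycle e c -> i < size c -> e (nth x0 c i) (nth x0 c (i.+1 %% size c)).
Proof.
case: c => // x p /(pathP x0) h ip; have := h i; rewrite size_rcons => /(_ ip).
move: ip; rewrite /= ltnS leq_eqVlt => /predU1P[->|ip].
  by rewrite modnn -rcons_cons !nth_rcons /= ltnSn ltnn eqxx.
by rewrite modn_small //= -rcons_cons !nth_rcons /= ltnS ltnW // ip.
Qed.

Lemma ordS_neq2 n (i : 'I_n) : 2 < n -> ordS (ordS i) != i.
Proof.
move=> n2; apply/eqP=> /(congr1 val) /=; have ni := ltn_ord i.
have [i1|i1] := leqP n i.+1.
  have -> : i.+1 = n by lia.
  by rewrite modnn modn_small; lia.
rewrite (modn_small i1); have [i2|i2] := leqP n i.+2; last by rewrite modn_small; lia.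
have -> : i.+2 = n by lia.
by rewrite modnn; lia.
Qed.

Section MapGraph.
Variables (V L : finType) (f : {ffun V * L -> V}) (D : {set V * L}).

Definition map_adj : rel V := fun x y => (x != y) && [exists p : V * L,
  (p \notin D) && ((p.1 == x) && (f p == y) || (p.1 == y) && (f p == x))].

Lemma map_graph_sym : symmetric map_adj.
Proof.
move=> x y; rewrite /map_adj eq_sym; congr (_ && _).
by apply: eq_existsb => p; rewrite orbC.
Qed.

Lemma map_graph_irr : irreflexive map_adj.
Proof. by move=> x; rewrite /map_adj eqxx. Qed.

Definition map_graph := SGraph map_graph_sym map_graph_irr.

End MapGraph.

(** The edges of a short cycle come from undeleted arcs, but these arcs form a cycle word, whose
    first arc is short and hence deleted. *)
Lemma map_graph_ucycle (V L : finType) (f : {ffun V * L -> V}) g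
    (c : seq (map_graph f (short_arcs g f))) :
  ucycle (@adj _) c -> 2 < size c -> g < size c.
Proof.
move=> /andP[cyc uc] c3; rewrite ltnNge; apply/negP=> cg.
have [x0 _] : exists x0 : V, x0 \in c.
  by case: c {cyc uc cg} c3 => // x c _; exists x; apply: mem_head.
case ec: (size c) => [|l]; first by rewrite ec in c3.
pose x (j : 'I_l.+1) : V := nth x0 c j.
have xI : injective x.
  by move=> i j /eqP; rewrite nth_uniq ?ec // => /eqP/val_inj.
have step (j : 'I_l.+1) : exists ib : L * bool,
    ((if ib.2 then x j else x (ordS j), ib.1) \notin short_arcs g f) &&
    (f (if ib.2 then x j else x (ordS j), ib.1) == (if ib.2 then x (ordS j) else x j)).
  have := cycle_nth x0 cyc (i := j); rewrite ec => /(_ (ltn_ord j)).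
  rewrite -[nth _ _ (_ %% _)]/(x (ordS j)) -[nth _ _ _]/(x j) /= /map_adj.
  case/andP=> _ /existsP[[v i]] /= /andP[pD /orP[]] /andP[/eqP e1 e2]; rewrite e1 in pD e2.
    by exists (i, true); rewrite pD.
  by exists (i, false); rewrite pD.
have {step}[ib ibP] := fin_all_exists step.
pose w := [ffun j => (x j, (ib j).1, (ib j).2)] : {ffun 'I_l.+1 -> V * L * bool}.
have srcE j : source w j = (if (ib j).2 then x j else x (ordS j), (ib j).1).
  by rewrite /source !ffunE.
have tgtE j : target w j = if (ib j).2 then x (ordS j) else x j.
  by rewrite /target !ffunE.
have fw j : f (source w j) = target w j.
  by rewrite srcE tgtE; apply/eqP; case/andP: (ibP j).
have wD j : source w j \notin short_arcs g f by rewrite srcE; case/andP: (ibP j).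
suff : cycle_word f w.
  move=> cw; case/negP: (wD ord0); rewrite ec in cg.
  by apply/bigcupP; exists (Ordinal cg) => //; apply: imset_f; rewrite inE.
apply/andP; split; last by apply/forallP=> j; rewrite fw.
(* Two steps along one arc in the same direction coincide. In opposite directions they would go back
   and forth along one edge, impossible in a cycle of length at least 3. *)
apply/injectiveP=> i j e.
have := congr1 f e; rewrite !fw !tgtE => e2.
have := congr1 fst e; rewrite !srcE /= => e1.
have nn (h : 'I_l.+1) : ordS (ordS h) != h by apply: ordS_neq2; rewrite -ec.
move: e1 e2; case: (ib i).2; case: (ib j).2 => // /xI e1 /xI e2 //.
  by have := nn j; rewrite -e1 e2 eqxx.
by have := nn j; rewrite -e2 e1 eqxx.
Qed.

Lemma exists_graph (q g : nat) : 1 < q -> exists H : sgraph,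
  [/\ 0 < #|H|,
      forall c : seq H, ucycle (@adj H) c -> 2 < size c -> g < size c
    & forall A : {set H}, #|H| <= q * #|A| ->
        exists x y, [/\ x \in A, y \in A & x -- y]].
Proof.
move=> /(@exists_map _ g.+1)[V [L [f [V0 fA]]]].
exists (map_graph f (short_arcs g.+1 f)); split=> // [c uc c3|A /fA[p [pD pA fpA]]].
  exact: ltnW (map_graph_ucycle uc c3).
exists p.1, (f p); split=> //=; apply/andP; split; last first.
  by apply/existsP; exists p; rewrite pD !eqxx.
(* A loop is a cycle word of length 1, hence short; the bound [g.+1] admits this length even for g =
   0. *)
apply: contra pD => /eqP pf; apply/bigcupP; exists ord0 => //.
apply/imsetP; exists [ffun=> (p.1, p.2, true)].
  rewrite inE; apply/andP; split; first by apply/injectiveP=> i j _; rewrite !ord1.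
  by apply/forallP=> j; rewrite /source /target !ffunE /= -surjective_pairing -pf.
by rewrite /source !ffunE -surjective_pairing.
Qed.

(** * Subdivisions *)

Lemma cycle_mkseq (T : Type) (e : rel T) (x : nat -> T) l :
  (forall k, k < l -> e (x k) (x k.+1)) -> x l = x 0 -> cycle e (mkseq x l).
Proof.
case: l => // l ex xl; rewrite /= -xl.
have nthS i : i <= l -> nth (x 0) (rcons (map x (iota 1 l)) (x l.+1)) i = x i.+1.
  rewrite nth_rcons size_map size_iota leq_eqVlt => /predU1P[->|il].
    by rewrite ltnn eqxx.
  by rewrite il (nth_map 0) ?size_iota // nth_iota.
apply/(pathP (x 0)) => i; rewrite size_rcons size_map size_iota => il.
rewrite nthS //; case: i il => [|i] il /=; first by rewrite xl; apply: ex.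
by rewrite nthS 1?ltnW //; apply: ex.
Qed.

Section SubdivisionFacts.
Variable H : sgraph.
Implicit Types x y : H.
Local Notation S := (subdivision H).

Lemma mem_edge_set x y : x -- y -> [set x; y] \in edge_set H.
Proof.
move=> xy; rewrite inE; apply/existsP; exists x.
by apply/existsP; exists y; rewrite xy /=.
Qed.

Lemma edge_setP (e : {set H}) : e \in edge_set H ->
  exists x y, x -- y /\ e = [set x; y].
Proof. by rewrite inE => /existsP[x /existsP[y /andP[xy /eqP->]]]; exists x, y. Qed.

Lemma edge_set_ends (e : {set H}) x y : e \in edge_set H ->
  x \in e -> y \in e -> x != y -> x -- y /\ e = [set x; y].
Proof.
case/edge_setP=> u [v [uv ->]]; rewrite !inE.
case/orP=> /eqP-> /orP[]/eqP-> //; rewrite ?eqxx //.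
by rewrite adj_sym setUC.
Qed.

Definition original (u : S) : bool := if u is inl _ then true else false.

Lemma original_adj (u v : S) : u -- v -> original v = ~~ original u.
Proof. by case: u v => [x|e] [y|e']. Qed.

(** [original] is a proper 2-colouring, hence injective on cliques. *)
Lemma clique_number_subdivision : clique_number S <= 2.
Proof.
apply/bigmax_leqP=> A /forall_inP cl.
rewrite -card_bool -(card_in_imset (f := original) (D := mem A)) ?max_card //.
move=> u v uA vA /eqP; apply: contraTeq => uv.
have /forall_inP/(_ v vA) := cl u uA; rewrite uv /= => /original_adj->.
by case: original.
Qed.

Lemma cycle_graph_adjS n (i : 'I_n) : 1 < n -> @adj (cycle_graph n) i (ordS i).
Proof.
move=> n1; rewrite /= /cycle_adj eqxx andbT; apply/eqP=> /(congr1 val) /=.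
have ni := ltn_ord i; have [i1|i1] := leqP n i.+1; last by rewrite modn_small //; lia.
have -> : i.+1 = n by lia.
by rewrite modnn; lia.
Qed.

Lemma iter_ordS n k (i : 'I_n) : iter k (@ordS n) i = (i + k) %% n :> nat.
Proof.
elim: k => [|k IH] /=; first by rewrite addn0 modn_small.
by rewrite IH -addn1 modnDml addn1 addnS.
Qed.

(** Going once around the cycle switches sides [n] times and ends where it began. *)
Lemma subdivision_odd_cycle n : 1 < n -> odd n ->
  ~ induced_subgraph (cycle_graph n) S.
Proof.
move=> n1 on [f _ fE].
have par k i : original (f (iter k (@ordS n) i)) = odd k (+) original (f i).
  elim: k => //= k IH.
  by rewrite (@original_adj (f (iter k (@ordS n) i))) ?IH ?addNb // fE cycle_graph_adjS.
have i : 'I_n by apply: (@Ordinal _ 0); lia.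
have := par n i; rewrite on (_ : iter n _ i = i); first by case: original.
by apply: val_inj; rewrite /= iter_ordS modnDr modn_small.
Qed.

(** The cycle alternates between original and subdivision vertices; started at an original one, its
    even positions trace a cycle of [H]. *)
Lemma subdivision_even_cycle l : 1 < l ->
    induced_subgraph (cycle_graph l.*2) S ->
  exists2 c : seq H, ucycle (@adj H) c & size c = l /\ 2 < l.
Proof.
move=> l1 [f fI fE]; set n := l.*2 in f fI fE.
have n4 : 4 <= n by rewrite /n; lia.
have [i oi] : exists i, original (f i).
  have i : 'I_n by apply: (@Ordinal _ 0); lia.
  case oi: (original (f i)); first by exists i.
  exists (ordS i); rewrite (@original_adj (f i)) ?oi // fE cycle_graph_adjS //; lia.
pose h k := f (iter k (@ordS n) i).
have hadj k : h k -- h k.+1 by rewrite fE cycle_graph_adjS //; lia.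
have hinj j k : j < n -> k < n -> h j = h k -> j = k.
  move=> jn kn /fI/(congr1 val) /=; rewrite !iter_ordS.
  by move/eqP; rewrite eqn_modDl !modn_small // => /eqP.
have hn : h n = h 0.
  by congr f; apply: val_inj; rewrite /= iter_ordS modnDr modn_small.
have odd_h k : original (h k) = ~~ odd k.
  by elim: k => [|k IH]; [rewrite oi | rewrite (original_adj (hadj k)) IH].
have [x hx] : exists x : nat -> H, forall k, h k.*2 = inl (x k).
  have x0 : H by case: (f i) oi.
  exists (fun k => if h k.*2 is inl y then y else x0) => k.
  by have := odd_h k.*2; rewrite odd_double; case: (h _).
have xinj j k : j < l -> k < l -> x j = x k -> j = k.
  move=> jl kl xx; apply: double_inj; apply: hinj; rewrite ?ltn_double //.
  by rewrite !hx xx.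
have xl : x l = x 0 by have := hn; rewrite -[h 0]/(h 0.*2) /n !hx => -[].
have hx2 k : k < l -> x k -- x k.+1 /\
    exists2 e, h k.*2.+1 = inr e & val e = [set x k; x k.+1].
  move=> kl; have := hadj k.*2; have := hadj k.*2.+1; have := odd_h k.*2.+1.
  rewrite -doubleS !hx /= odd_double.
  case: (h _) => //= e _ xk' xk.
  have xx : x k != x k.+1.
    apply/eqP; case: (ltngtP k.+1 l) => [k1||k1]; [| lia |].
      by move/(xinj _ _ kl k1); lia.
    by rewrite k1 xl => /(xinj k 0); lia.
  have [xk1 ee] := edge_set_ends (valP e) xk xk' xx.
  by split=> //; exists e.
exists (mkseq x l); last first.
  (* For l = 2 the two subdivision vertices would have the same ends and coincide. *)
  rewrite size_mkseq; split=> //; rewrite ltn_neqAle l1 andbT; apply/eqP=> l2.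
  have [_ [e0 h1 v0]] := hx2 0 ltac:(lia); have [_ [e1 h3 v1]] := hx2 1 l1.
  suff /hinj : h 0.*2.+1 = h 1.*2.+1 by lia.
  rewrite h1 h3; congr inr; apply: val_inj; rewrite v0 v1.
  by rewrite l2 xl setUC.
apply/andP; split; last first.
  by rewrite map_inj_in_uniq ?iota_uniq // => j k; rewrite !mem_iota /=; apply: xinj.
by apply: cycle_mkseq xl => k /hx2[].
Qed.

End SubdivisionFacts.

(** * Star colourings and independent sets *)

(** All four vertices lie in one component, a star, whose centre is on both edges ab and cd. *)
Lemma star_forest_disjoint_edges (G : sgraph) (a b c d : G) : is_star_forest G ->
  a -- b -> b -- c -> c -- d -> [|| a == c, a == d, b == c | b == d].
Proof.
move=> /forallP/(_ a)/existsP[z /forallP st] ab bc cd.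
have ka : connect (@adj G) a a by [].
have kb : connect (@adj G) a b by apply: connect1.
have kc : connect (@adj G) a c by apply: connect_trans (connect1 bc).
have kd : connect (@adj G) a d by apply: connect_trans (connect1 cd).
have stx x y : connect (@adj G) a x -> connect (@adj G) a y -> x -- y ->
    (x == val z) || (y == val z).
  rewrite -![connect _ a _](in_set (connect (@adj G) a)) => xC yC xy.
  have /forallP/(_ (Sub y yC)) := st (Sub x xC).
  by rewrite /= /induced_adj /= xy eq_sym eqb_id => /andP[_]; rewrite -!val_eqE.
move: (stx a b ka kb ab) (stx c d kc kd cd); move: (val z) => w.
by case/orP=> /eqP-> /orP[]/eqP->; rewrite eqxx ?orbT.
Qed.

Lemma color_pigeonhole (T : finType) m (c : T -> 'I_m) :
  0 < #|T| -> exists i, #|T| <= m * #|[set x | c x == i]|.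
Proof.
move=> T0; apply/existsP; apply: contraTT T0; rewrite negb_exists => /forallP small.
have eT : #|T| = \sum_i #|[set x | c x == i]|.
  rewrite -sum1_card (partition_big c predT) //=; apply: eq_bigr => i _.
  by rewrite -sum1_card; apply: eq_bigl => x; rewrite inE.
have : m * #|T| <= \sum_(i < m) (#|T|.-1).
  rewrite {1}eT big_distrr /=; apply: leq_sum => i _.
  by have := small i; rewrite -ltnNge; case: #|T|.
by rewrite sum_nat_const card_ord; case: m c small eT => [c _ ->|m c _ _]; rewrite ?big_ord0 //;
  case: #|T| => // x; rewrite leq_mul2l ltnn.
Qed.

(* Inside the largest colour class of original vertices, the edges at a given
   vertex x have subdivision vertices of distinct colours, by excluding the
   bicoloured path y - {x,y} - x - {x,y'}; hence degrees there are at most m. *)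
Lemma star_coloring_independent (H : sgraph) m (c : subdivision H -> 'I_m) :
    star_coloring c -> 0 < #|H| ->
  exists2 I : {set H}, #|H| <= m * m.+1 * #|I| &
    forall x y, x \in I -> y \in I -> ~~ (x -- y).
Proof.
case/andP=> /forallP prop /forallP star H0.
pose C i := [set x : H | c (inl x) == i].
have [i Ci] : exists i, #|H| <= m * #|C i| by apply: color_pigeonhole.
pose indep (I : {set H}) := (I \subset C i) && [forall x in I, forall y in I, ~~ (x -- y)].
have : indep set0.
  by rewrite /indep sub0set; apply/forall_inP=> x; rewrite inE.
case/maxset_exists=> I /maxsetP[/andP[IC /forall_inP Iind] Imax] _.
exists I; last by move=> x y xI yI; have /forall_inP := Iind x xI; apply.
apply: leq_trans Ci _; rewrite -mulnA leq_mul2l; apply/orP; right.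
pose N x := [set y in C i | x -- y].
have cN x : x \in C i -> #|N x| <= m.
  move=> xC; rewrite -[X in _ <= X]card_ord.
  (* [ec y] is the colour of the vertex subdividing xy; the default [i] is not reached on [N x]. *)
  pose ec y := if insub [set x; y] : {? e : {set H} | e \in edge_set H} is Some e
               then c (inr e : subdivision H) else i.
  have ecE y : y \in N x -> [/\ c (inl y : subdivision H) = i, y != x &
      exists2 e : {e | e \in edge_set H}, ec y = c (inr e : subdivision H)
                                        & val e = [set x; y]].
    rewrite !inE => /andP[/eqP cy xy]; split=> //.
      by apply: contraTneq xy => ->; rewrite adj_irr.
    rewrite /ec (insubT (fun e => e \in edge_set H) (mem_edge_set xy)).
    by exists (exist (fun e => e \in edge_set H) _ (mem_edge_set xy)).
  rewrite -(card_in_imset (f := ec) (D := mem (N x))) ?max_card //.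
  move=> y y' yN y'N eyy; have [cy yx [e eE ev]] := ecE y yN.
  have [_ _ [e' eE' ev']] := ecE y' y'N.
  have cx : c (inl x : subdivision H) = i by apply/eqP; rewrite inE in xC.
  pose j := ec y; pose K := color_class c i :|: color_class c j.
  have ij : i != j.
    have /forallP/(_ (inr e))/implyP := prop (inl y); rewrite cy -eE; apply.
    by rewrite /= ev !inE eqxx orbT.
  have yK : (inl y : subdivision H) \in K by rewrite !inE cy eqxx.
  have xK : (inl x : subdivision H) \in K by rewrite !inE cx eqxx.
  have eK : (inr e : subdivision H) \in K by rewrite !inE /j eE eqxx orbT.
  have e'K : (inr e' : subdivision H) \in K by rewrite !inE /j eyy eE' eqxx orbT.
  pose k u (uK : u \in K) : induced K := exist (fun v => v \in K) u uK.
  have /forallP/(_ j)/implyP/(_ ij) := star i.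
  move/(@star_forest_disjoint_edges _ (k _ yK) (k _ eK) (k _ xK) (k _ e'K)).
  rewrite /= /induced_adj /= ev ev' !inE !eqxx orbT => /(_ isT isT isT).
  rewrite -!val_eqE /= => /orP[] /eqP[]; first by move/eqP; rewrite (negPf yx).
  move=> ee; have : y \in val e' by rewrite -ee ev !inE eqxx orbT.
  by rewrite ev' !inE (negPf yx) => /eqP.
(* By maximality of [I], the closed neighbourhoods of its vertices within [C i], of size at most
   m+1, cover [C i]. *)
apply: (@leq_trans #|\bigcup_(x in I) (x |: N x)|).
  apply/subset_leq_card/subsetP=> y yC; apply/bigcupP.
  have [yI|yI] := boolP (y \in I); first by exists y; rewrite ?setU11.
  apply/exists_inP; apply: contraTT yI => /exists_inPn no; rewrite negbK.
  rewrite -(Imax (y |: I)) ?setU11 ?subsetUr //.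
  rewrite /indep subUset sub1set yC IC /=.
  have noadj x : x \in I -> ~~ (x -- y).
    move=> xI; have := no x xI; rewrite !inE negb_or => /andP[_].
    by rewrite inE in yC; rewrite yC.
  apply/forall_inP=> u /setU1P[->|uI]; apply/forall_inP=> v /setU1P[->|vI].
  - by rewrite adj_irr.
  - by rewrite adj_sym noadj.
  - exact: noadj.
  - by have /forall_inP := Iind u uI; apply.
apply: leq_trans (leq_card_bigcup _ _) _.
rewrite mulnC -sum_nat_const; apply: leq_sum => x xI.
by rewrite -add1n (leq_trans (leq_card_setU _ _)) // cards1 leq_add2l cN // (subsetP IC).
Qed.

(** * Completing a forest to a tree *)

Section Apex.
Variable F : sgraph.

(* Joining a new vertex to one root per component turns a forest into a tree. *)
Definition apex_adj : rel (option F) := fun u v =>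
  match u, v with
  | Some x, Some y => x -- y
  | Some x, None | None, Some x => x \in roots (@adj F)
  | None, None => false
  end.

Lemma apex_sym : symmetric apex_adj.
Proof. by case=> [x|] [y|] //=; apply: adj_sym. Qed.

Lemma apex_irr : irreflexive apex_adj.
Proof. by case=> //= x; apply: adj_irr. Qed.

Definition apex := SGraph apex_sym apex_irr.

Let Fsym : connect_sym (@adj F).
Proof. by apply: sym_connect_sym; apply: adj_sym. Qed.

Let path_Some x p : path apex_adj (Some x) (map Some p) = path (@adj F) x p.
Proof. by elim: p x => //= y p IH x; rewrite IH. Qed.

Let map_Some (c : seq (option F)) : None \notin c -> exists p, c = map Some p.
Proof.
elim: c => [|[x|] c IH]; [by exists [::] | | by rewrite inE].
by rewrite inE => /IH[p ->]; exists (x :: p).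
Qed.

(** A cycle through the apex would leave it and return to it by roots of the same component. These
    are equal, so only one other vertex is visited. *)
Lemma apex_tree : is_forest F -> is_tree apex.
Proof.
move=> Ff; split; first split.
- by apply/card_gt0P; exists None.
- have apexsym : connect_sym apex_adj by apply/sym_connect_sym/apex_sym.
  suff toN u : connect apex_adj u None.
    by move=> u v; apply: connect_trans (toN u) _; rewrite apexsym.
  case: u => // x; apply: (@connect_trans _ _ (Some (root (@adj F) x))).
    have /connectP[p pp ->] := connect_root (@adj F) x.
    by apply/connectP; exists (map Some p); rewrite ?path_Some ?last_map.
  by apply: connect1; apply: (roots_root Fsym).
- move=> c uc; have [Nc|/map_Some[p cp]] := boolP (None \in c); last first.
    rewrite cp size_map; apply: Ff; move: uc; rewrite cp /ucycle.
    rewrite map_inj_uniq; last exact: Some_inj.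
    case: p {cp} => //= x p.
    by rewrite -map_rcons path_Some.
  have [i c' rc] := rot_to Nc.
  move: uc; rewrite -(rot_ucycle i) -(size_rot i) rc => /andP[/= pc /andP[Nc' uc']].
  case: (map_Some Nc') pc uc' => p -> {Nc' rc c'}.
  case: p => [//|x p] /=; rewrite rcons_path path_Some last_map => /and3P[/= rx pp rl].
  move=> /andP[xp _]; suff -> : p = [::] by [].
  have : connect (@adj F) x (last x p) by apply/connectP; exists p.
  move/(rootP Fsym); rewrite (eqP rx) (eqP rl) => e.
  case: p xp {pp rl} e => // y p /negP xp /= e; case: xp; apply: map_f.
  by rewrite e mem_last.
Qed.

End Apex.

(** * Copies of a graph in a subdivision of large girth *)

Section Support.
Variables (T H : sgraph) (f : T -> subdivision H).

(** A subdivision vertex contributes both ends of its edge, so that this edge survives in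
    [induced support]. *)
Definition vertex_support (u : subdivision H) : {set H} :=
  match u with inl x => [set x] | inr e => val e end.

Definition support : {set H} := \bigcup_(t : T) vertex_support (f t).

Lemma card_support : #|support| <= 2 * #|T|.
Proof.
apply: leq_trans (leq_card_bigcup _ _) _.
rewrite mulnC -sum_nat_const; apply: leq_sum => t _.
case: (f t) => [x|e] /=; first by rewrite cards1.
by have [x [y [_ ->]]] := edge_setP (valP e); rewrite cards2; case: eqP.
Qed.

(** The copy of [T] lies in the subdivision of [induced support], which the subdivision of its apex
    tree contains. *)
Lemma support_subgraph_tree : injective f ->
    (forall x y, x -- y -> f x -- f y) -> is_forest (induced support) ->
  exists S, is_tree S /\ subgraph T (subdivision S).
Proof.
move=> fI fE Wf; exists (apex (induced support)); split; first exact: apex_tree.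
pose S := apex (induced support).
pose g (x : H) : S := (insub x : option {x | x \in support}).
have gE x (xW : x \in support) : g x = Some (exist (fun y => y \in support) x xW).
  by rewrite /g insubT.
have gI : {in support &, injective g}.
  by move=> x y xW yW; rewrite !gE => -[].
have fW t : {subset vertex_support (f t) <= support}.
  by move=> x xt; apply/bigcupP; exists t.
have ge (e : {set H}) : e \in edge_set H -> {subset e <= support} ->
    g @: e \in edge_set S.
  case/edge_setP=> x [y [xy ->]] eW; rewrite imsetU1 imset_set1.
  have xW : x \in support by apply: eW; rewrite !inE eqxx.
  have yW : y \in support by apply: eW; rewrite !inE eqxx orbT.
  by apply: mem_edge_set; rewrite !gE.
(* The default [inl None] is never taken on the image of [f], whose edges have both ends in the
   support. *)
pose h (u : subdivision H) : subdivision S := match u with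
  | inl x => inl (g x)
  | inr e => if insub (g @: val e) : {? e : {set S} | e \in edge_set S} is Some e'
             then inr e' else inl None end.
have he t (e : {e | e \in edge_set H}) : f t = inr e ->
    exists2 e' : {e : {set S} | e \in edge_set S}, h (f t) = inr e' & val e' = g @: val e.
  move=> fte; have eW : {subset val e <= support} by have := fW t; rewrite fte.
  rewrite fte /= (insubT (fun e => e \in edge_set S) (ge _ (valP e) eW)).
  by exists (exist (fun e => e \in edge_set S) _ (ge _ (valP e) eW)).
exists (h \o f) => [s t /= | s t /fE].
  case fs: (f s) (fW s) => [x|e] sW; case ft: (f t) (fW t) => [y|e'] tW.
  - by case=> xy; apply: fI; rewrite fs ft (gI _ _ (sW _ (set11 x)) (tW _ (set11 y)) xy).
  - by have [e1 h1 _] := he _ _ ft; rewrite -ft h1.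
  - by have [e1 h1 _] := he _ _ fs; rewrite -fs h1.
  - have [e1 h1 v1] := he _ _ fs; have [e2 h2 v2] := he _ _ ft.
    rewrite -fs -ft h1 h2 => -[] e12; apply: fI; rewrite fs ft; congr inr.
    have : g @: val e = g @: val e' by rewrite -v1 -v2 e12.
    move=> im; apply/val_inj/setP => x.
    have sub (A B : {set H}) : {subset A <= support} -> {subset B <= support} ->
        g @: A = g @: B -> x \in A -> x \in B.
      move=> AW BW AB xA; have : g x \in g @: B by rewrite -AB imset_f.
      by case/imsetP=> y yB /(gI _ _ (AW _ xA) (BW _ yB))->.
    by apply/idP/idP; apply: sub.
rewrite -[(h \o f) s]/(h (f s)) -[(h \o f) t]/(h (f t)).
case fs: (f s) => [x|e]; case ft: (f t) => [y|e'] // xe.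
  by have [e1 h1 v1] := he _ _ ft; rewrite -ft h1 /= v1 imset_f.
by have [e1 h1 v1] := he _ _ fs; rewrite -fs h1 /= v1 imset_f.
Qed.

End Support.

(** A cycle of the induced graph is a cycle of [H] on at most |W| vertices. *)
Lemma small_induced_forest (H : sgraph) (W : {set H}) g : #|W| <= g ->
  (forall c : seq H, ucycle (@adj H) c -> 2 < size c -> g < size c) ->
  is_forest (induced W).
Proof.
move=> Wg girth c /andP[cyc uc]; rewrite ltnNge; apply/negP=> c3.
have /girth : ucycle (@adj H) (map val c).
  rewrite /ucycle map_inj_uniq ?uc ?andbT; last exact: val_inj.
  by case: c cyc {uc c3} => //= x p; rewrite -map_rcons path_map.
rewrite size_map => /(_ c3); apply/negP; rewrite -leqNgt.
apply: leq_trans Wg; rewrite -(card_uniqP uc) -(card_sig (mem W)).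
exact: max_card.
Qed.

Theorem lemma4 (T : sgraph) (k : nat)
  (T_forest : is_forest T)
  (T_nsub : ~ exists S : sgraph, is_tree S /\ subgraph T (subdivision S))
  (k_pos : 0 < k) :
  ~ chi_s_bounded (free_class T k).
Proof.
(* Subdivisions have clique number at most 2, so only these three values of [f] matter. *)
case=> f fP; pose M := maxn (f 0) (maxn (f 1) (f 2)).
(* Girth above [k] excludes the even cycles up to 2k, and girth above 2|T| makes the support of a
   copy of [T] span a forest. The density bound exceeds the M(M+1) coming from a star colouring with
   at most [M] colours. *)
have [H [H0 girth edge]] := @exists_graph (M * M.+1).+2 (k + 2 * #|T|) isT.
have /fP : free_class T k (subdivision H).
  split.
  - case=> h hI hE; apply: T_nsub; apply: (support_subgraph_tree hI).
      by move=> x y; rewrite hE.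
    apply: small_induced_forest (card_support h) _ => c uc c3.
    exact: leq_ltn_trans (leq_addl _ _) (girth c uc c3).
  - move=> n /andP[n4 nk] cn; have [on|en] := boolP (odd n).
      by apply: subdivision_odd_cycle cn; lia.
    have en2 : n = n./2.*2 by rewrite even_halfK.
    rewrite en2 in cn; have [|c uc [sc l3]] := subdivision_even_cycle _ cn; first by lia.
    by have := girth c uc; rewrite sc => /(_ l3); lia.
  - by case=> n [on n5]; apply: subdivision_odd_cycle; lia.
rewrite /star_chromatic_number; case: ex_minnP => m /existsP[c cs] _ mf.
have {mf} mM : m <= M.
  apply: leq_trans mf _; have := clique_number_subdivision H.
  by rewrite /M; case: clique_number => [|[|[|]]] // _; lia.
have [I cI indep] := star_coloring_independent cs H0.
have [|x [y [xI yI xy]]] := edge I; last by have := indep x y xI yI; rewrite xy.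
by apply: leq_trans cI _; rewrite leq_mul2r; apply/orP; right; nia.
Qed.
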